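(* Let $\Phi$ be a field of characteristic zero and let $n\ge 1$. The elements $$\theta(i,i_1,\dots,i_m,j_1,\dots,j_m)=x_i(x_{i_1}x_{j_1})(x_{i_2}x_{j_2})\cdots(x_{i_m}x_{j_m})x_{k_1}x_{k_2}\cdots x_{k_{n-2m-1}},$$ where $m$ ranges over the integers with $m\ge 0$ and $2m+1\le n$, where $i,i_1,\dots,i_m,j_1,\dots,j_m,k_1,\dots,k_{n-2m-1}$ are pairwise distinct with $$\{i,i_1,\dots,i_m,j_1,\dots,j_m,k_1,\dots,k_{n-2m-1}\}=\{1,2,\dots,n\},$$ and where $i_s<j_s$ for $s=1,\dots,m$, $i_1<i_2<\dots<i_m$, $j_1<j_2<\dots<j_m$, and $k_1<k_2<\dots<k_{n-2m-1}$, form a basis of the vector space $P_n(\widetilde{\mathbf{V}}_3)$.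
   Context: A Leibniz algebra over $\Phi$ is a (not necessarily associative) linear algebra with bilinear multiplication satisfying the identity $(xy)z\equiv (xz)y+x(yz)$. Brackets are omitted in left-normed products: $abc\cdots d=(((ab)c)\cdots)d$; a bracketed expression such as $(x_{i_1}x_{j_1})$ is a single factor in such a product. Let $T=\Phi[t]$ be the polynomial ring in the variable $t$, and let $H$ be the three-dimensional Heisenberg Lie algebra over $\Phi$ with basis $\{a,b,c\}$, multiplication $ba=-ab=c$, and all other products of basis elements zero. $T$ is made into a right $H$-module by $fa=f'$ (the derivative with respect to $t$), $fb=tf$, $fc=f$ for $f\in T$. Let $\widetilde{H}=H\oplus T$ (direct sum of vector spaces) with multiplication $(x+f)(y+g)=xy+fy$ for $x,y\in H$, $f,g\in T$; this is a Leibniz algebra. $\widetilde{\mathbf{V}}_3$ is the variety of Leibniz algebras over $\Phi$ generated by $\widetilde{H}$, i.e. the class of all algebras over $\Phi$ satisfying all identities of $\widetilde{H}$. For a variety $\mathbf{V}$, $F(X,\mathbf{V})$ is its relatively free algebra on the countable set of free generators $X=\{x_1,x_2,\dots\}$, and $P_n(\mathbf{V})$ is the subspace of $F(X,\mathbf{V})$ of elements multilinear in $x_1,\dots,x_n$. *)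

(* Defs.v *)
From HB Require Import structures.
From mathcomp Require Import all_boot all_order all_algebra.
From mathcomp Require Import generic_quotient ring_quotient.
From mathcomp Require Import ring finmap boolp.
From mathcomp.multinomials Require Import monalg.

Set Implicit Arguments.
Unset Strict Implicit.
Unset Printing Implicit Defensive.

Import GRing.Theory.
Local Open Scope ring_scope.
Local Open Scope quotient_scope.

(* Linear algebras, not necessarily associative nor unital. *)
HB.mixin Record isNonAssocAlgebra (Phi : fieldType) A
    of GRing.Lmodule Phi A := {
  namul : A -> A -> A;
  namul_linearl : forall (k : Phi) (x y z : A),
    namul (k *: x + y) z = k *: namul x z + namul y z;
  namul_linearr : forall (k : Phi) (x y z : A),
    namul z (k *: x + y) = k *: namul z x + namul z y
}.

#[short(type="naAlgType")]
HB.structure Definition NonAssocAlgebra (Phi : fieldType) :=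
  {A of GRing.Lmodule Phi A & isNonAssocAlgebra Phi A}.

Notation "x ** y" := (namul x y) (at level 40, left associativity) : ring_scope.

Section NonAssocTheory.
Variables (Phi : fieldType) (A : naAlgType Phi).
Implicit Types x y z : A.

Lemma namul0l z : (0 : A) ** z = 0.
Proof.
have := namul_linearl (1 : Phi) (0 : A) 0 z.
by rewrite !scale1r addr0 => /esym/eqP; rewrite -subr_eq0 addrK => /eqP.
Qed.

Lemma namul0r z : z ** (0 : A) = 0.
Proof.
have := namul_linearr (1 : Phi) (0 : A) 0 z.
by rewrite !scale1r addr0 => /esym/eqP; rewrite -subr_eq0 addrK => /eqP.
Qed.

Lemma namulDl x y z : (x + y) ** z = x ** z + y ** z.
Proof. by have := namul_linearl 1 x y z; rewrite !scale1r. Qed.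

Lemma namulDr x y z : z ** (x + y) = z ** x + z ** y.
Proof. by have := namul_linearr 1 x y z; rewrite !scale1r. Qed.

Lemma namulZl k x z : (k *: x) ** z = k *: (x ** z).
Proof. by have := namul_linearl k x 0 z; rewrite namul0l !addr0. Qed.

Lemma namulZr k x z : z ** (k *: x) = k *: (z ** x).
Proof. by have := namul_linearr k x 0 z; rewrite namul0r !addr0. Qed.

Lemma namulBl x y z : (x - y) ** z = x ** z - y ** z.
Proof. by rewrite -[- y]scaleN1r namulDl namulZl scaleN1r. Qed.

Lemma namulBr x y z : z ** (x - y) = z ** x - z ** y.
Proof. by rewrite -[- y]scaleN1r namulDr namulZr scaleN1r. Qed.

Lemma namul_suml (I : Type) (s : seq I) (F : I -> A) z :
  (\sum_(i <- s) F i) ** z = \sum_(i <- s) F i ** z.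
Proof.
elim: s => [|i s IHs]; first by rewrite !big_nil namul0l.
by rewrite !big_cons namulDl IHs.
Qed.

Lemma namul_sumr (I : Type) (s : seq I) (F : I -> A) z :
  z ** (\sum_(i <- s) F i) = \sum_(i <- s) z ** F i.
Proof.
elim: s => [|i s IHs]; first by rewrite !big_nil namul0r.
by rewrite !big_cons namulDr IHs.
Qed.

End NonAssocTheory.

Definition leibniz (Phi : fieldType) (A : naAlgType Phi) : Prop :=
  forall x y z : A, x ** y ** z = x ** z ** y + x ** (y ** z).

(* Nonassociative monomials in the free generators.  Generators are numbered
   from 0: the generator of index k is the one usually written x_(k+1). *)
Inductive namon : Type :=
  | NVar of nat
  | NMul of namon & namon.

Fixpoint namon_to_tree (t : namon) : GenTree.tree nat :=
  match t with
  | NVar k => GenTree.Leaf k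
  | NMul t1 t2 => GenTree.Node 0 [:: namon_to_tree t1; namon_to_tree t2]
  end.

Fixpoint tree_to_namon (t : GenTree.tree nat) : option namon :=
  match t with
  | GenTree.Leaf k => Some (NVar k)
  | GenTree.Node _ [:: t1; t2] =>
      match tree_to_namon t1, tree_to_namon t2 with
      | Some u1, Some u2 => Some (NMul u1 u2)
      | _, _ => None
      end
  | _ => None
  end.

Lemma namon_to_treeK : pcancel namon_to_tree tree_to_namon.
Proof. by elim=> //= t1 -> t2 ->. Qed.

HB.instance Definition _ := Countable.copy namon (pcan_type namon_to_treeK).

Fixpoint leaves (t : namon) : seq nat :=
  match t with
  | NVar k => [:: k]
  | NMul t1 t2 => leaves t1 ++ leaves t2
  end.

(* The free nonassociative algebra: the free module on the monomials, with the
   bilinear extension of their formal product. *)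
Definition freeNA (Phi : fieldType) : Type := {malg Phi[namon]}.

HB.instance Definition _ (Phi : fieldType) :=
  GRing.Lmodule.copy (freeNA Phi) {malg Phi[namon]}.

Section FreeNA.
Variable Phi : fieldType.
Implicit Types f g : freeNA Phi.

(* Extension by linearity of a map defined on monomials. *)
Definition lin_ext (V : lmodType Phi) (h : namon -> V) (f : freeNA Phi) : V :=
  \sum_(t <- msupp f) f@_t *: h t.

Lemma lin_extEw (V : lmodType Phi) (h : namon -> V) f (d : {fset namon}) :
  (msupp f `<=` d)%fset -> lin_ext h f = \sum_(t <- d) f@_t *: h t.
Proof.
move=> fd; rewrite /lin_ext; apply: big_fset_incl => // t _ /mcoeff_outdom->.
by rewrite scale0r.
Qed.

Lemma lin_ext_linear (V : lmodType Phi) (h : namon -> V) :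
  linear (lin_ext h).
Proof.
move=> k f g; pose d := (msupp (k *: f + g) `|` (msupp f `|` msupp g))%fset.
rewrite (@lin_extEw _ _ _ d) ?fsubsetUl //.
rewrite (@lin_extEw _ _ f d); last first.
  by apply/fsubsetP => t tf; rewrite !inE tf orbT.
rewrite (@lin_extEw _ _ g d); last first.
  by apply/fsubsetP => t tg; rewrite !inE tg !orbT.
rewrite scaler_sumr -big_split /=; apply: eq_bigr => t _.
by rewrite mcoeffD mcoeffZ scalerDl scalerA.
Qed.

HB.instance Definition _ (V : lmodType Phi) (h : namon -> V) :=
  GRing.isLinear.Build Phi (freeNA Phi) V *:%R (lin_ext h) (lin_ext_linear h).

Lemma lin_extU (V : lmodType Phi) (h : namon -> V) (t : namon) :
  lin_ext h << t >> = h t.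
Proof.
rewrite (@lin_extEw _ _ _ [fset t]%fset) ?msuppU_le //.
by rewrite big_seq_fset1 mcoeffUU scale1r.
Qed.

Definition freeNA_mul f g : freeNA Phi :=
  lin_ext (fun s => lin_ext (fun t => << NMul s t >> : freeNA Phi) g) f.

Lemma freeNA_mul_linearl k f g h :
  freeNA_mul (k *: f + g) h = k *: freeNA_mul f h + freeNA_mul g h.
Proof. exact: linearP. Qed.

Lemma freeNA_mul_linearr k f g h :
  freeNA_mul h (k *: f + g) = k *: freeNA_mul h f + freeNA_mul h g.
Proof.
rewrite /freeNA_mul {1 3 5}/lin_ext scaler_sumr -big_split /=.
by apply: eq_bigr => t _; rewrite linearP scalerDr !scalerA mulrC.
Qed.

HB.instance Definition _ :=
  isNonAssocAlgebra.Build Phi (freeNA Phi) freeNA_mul_linearl freeNA_mul_linearr.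

Fixpoint mon_eval (A : naAlgType Phi) (v : nat -> A) (t : namon) : A :=
  match t with
  | NVar k => v k
  | NMul t1 t2 => mon_eval v t1 ** mon_eval v t2
  end.

Definition na_eval (A : naAlgType Phi) (v : nat -> A) : freeNA Phi -> A :=
  lin_ext (mon_eval v).

HB.instance Definition _ (A : naAlgType Phi) (v : nat -> A) :=
  GRing.Linear.on (na_eval v).

Lemma na_evalM (A : naAlgType Phi) (v : nat -> A) f g :
  na_eval v (f ** g) = na_eval v f ** na_eval v g.
Proof.
have evE h : na_eval v h = \sum_(t <- msupp h) h@_t *: mon_eval v t by [].
rewrite [f ** g]/(freeNA_mul f g) /freeNA_mul {1}/lin_ext linear_sum /=.
rewrite (evE f) namul_suml; apply: eq_bigr => s _.
rewrite linearZ /= namulZl; congr (_ *: _).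
rewrite {1}/lin_ext linear_sum /= (evE g) namul_sumr.
apply: eq_bigr => t _; rewrite linearZ /= namulZr; congr (_ *: _).
exact: lin_extU.
Qed.

Definition satisfies (A : naAlgType Phi) f : Prop :=
  forall v : nat -> A, na_eval v f = 0.

(* The variety generated by B, as a class of algebras. *)
Definition variety_gen (B A : naAlgType Phi) : Prop :=
  forall f, satisfies B f -> satisfies A f.

Definition identity_of (V : naAlgType Phi -> Prop) f : Prop :=
  forall A, V A -> satisfies A f.

Definition identities (V : naAlgType Phi -> Prop) : pred (freeNA Phi) :=
  fun f => `[< identity_of V f >].

End FreeNA.

Section RelativelyFree.
Variables (Phi : fieldType) (V : naAlgType Phi -> Prop).

Lemma identities_zmod_closed : zmod_closed (identities V).
Proof.
split; first by apply/asboolP => A _ v; rewrite linear0.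
move=> f g /asboolP idf /asboolP idg; apply/asboolP => A VA v.
by rewrite linearB /= idf ?idg ?subrr.
Qed.

HB.instance Definition _ :=
  GRing.isZmodClosed.Build (freeNA Phi) (identities V) identities_zmod_closed.

Definition Tideal : zmodClosed (freeNA Phi) :=
  GRing.ZmodClosed.clone (freeNA Phi) (identities V) _.

(* The relatively free algebra F(X, V): the free nonassociative algebra modulo
   the ideal of all identities of V. *)
Definition relfree : Type := Quotient.quot Tideal.

HB.instance Definition _ := GRing.Zmodule.copy relfree (Quotient.quot Tideal).

Definition relproj (f : freeNA Phi) : relfree :=
  \pi_(Quotient.quot Tideal) f.

Definition relrepr (u : relfree) : freeNA Phi :=
  repr (u : Quotient.quot Tideal).

Lemma relreprK : cancel relrepr relproj.
Proof. exact: reprK. Qed.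

Lemma relproj_eq f g : relproj f = relproj g <-> identity_of V (f - g).
Proof.
split=> [/eqP|H]; first by rewrite -Quotient.idealrBE => /asboolP.
by apply/eqP; rewrite /relproj -Quotient.idealrBE; apply/asboolP.
Qed.

Lemma relprojD : {morph relproj : f g / f + g}.
Proof. by move=> f g; rewrite /relproj Quotient.pi_add. Qed.

Definition relscale (k : Phi) (u : relfree) : relfree :=
  relproj (k *: relrepr u).

Lemma relprojZ k f : relproj (k *: f) = relscale k (relproj f).
Proof.
apply/relproj_eq => A VA v; rewrite -scalerBr linearZ /=.
have /relproj_eq -> // := esym (relreprK (relproj f)).
by rewrite scaler0.
Qed.

Lemma relscaleA k1 k2 u : relscale k1 (relscale k2 u) = relscale (k1 * k2) u.
Proof. by rewrite -[u]relreprK -!relprojZ scalerA. Qed.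

Lemma relscale1 : left_id 1 relscale.
Proof. by move=> u; rewrite -[u]relreprK -!relprojZ scale1r. Qed.

Lemma relscaleDr : right_distributive relscale +%R.
Proof.
move=> k u w; rewrite -[u]relreprK -[w]relreprK -relprojD -!relprojZ.
by rewrite -relprojD scalerDr.
Qed.

Lemma relscaleDl u : {morph relscale^~ u : k1 k2 / k1 + k2}.
Proof. by move=> k1 k2; rewrite -[u]relreprK -!relprojZ scalerDl relprojD. Qed.

HB.instance Definition _ := GRing.Zmodule_isLmodule.Build Phi relfree
  relscaleA relscale1 relscaleDr relscaleDl.

Lemma relproj_linear : linear relproj.
Proof. by move=> k f g; rewrite relprojD relprojZ. Qed.

HB.instance Definition _ :=
  GRing.isLinear.Build Phi (freeNA Phi) relfree *:%R relproj relproj_linear.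

Definition relmul (u w : relfree) : relfree := relproj (relrepr u ** relrepr w).

Lemma relprojM f g : relproj (f ** g) = relmul (relproj f) (relproj g).
Proof.
apply/relproj_eq => A VA v; rewrite linearB /= !na_evalM.
have ev h : na_eval v (relrepr (relproj h)) = na_eval v h.
  apply/eqP; rewrite -subr_eq0 -linearB; apply/eqP.
  by have /relproj_eq := relreprK (relproj h); apply.
by rewrite !ev subrr.
Qed.

Lemma relmul_linearl (k : Phi) (x y z : relfree) :
  relmul (k *: x + y) z = k *: relmul x z + relmul y z.
Proof.
rewrite -[x]relreprK -[y]relreprK -[z]relreprK -linearP -!relprojM.
by rewrite namul_linearl linearP.
Qed.

Lemma relmul_linearr (k : Phi) (x y z : relfree) :
  relmul z (k *: x + y) = k *: relmul z x + relmul z y.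
Proof.
rewrite -[x]relreprK -[y]relreprK -[z]relreprK -linearP -!relprojM.
by rewrite namul_linearr linearP.
Qed.

HB.instance Definition _ :=
  isNonAssocAlgebra.Build Phi relfree relmul_linearl relmul_linearr.

Definition relgen (k : nat) : relfree := relproj << NVar k >>.

Definition multilinear_mon (n : nat) (t : namon) : bool :=
  perm_eq (leaves t) (iota 0 n).

(* P_n(V): the classes of combinations of monomials in which each of the first
   n generators occurs exactly once, and no other generator occurs. *)
Definition multilinear_part (n : nat) (u : relfree) : Prop :=
  exists f : freeNA Phi,
    (forall t, t \in msupp f -> multilinear_mon n t) /\ u = relproj f.

End RelativelyFree.

(* The family of the e i, for i in I satisfying D, is a basis of the subspace
   P; the families considered need not be finite. *)
Definition is_basis (Phi : fieldType) (V : lmodType Phi) (P : V -> Prop)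
    (I : eqType) (D : pred I) (e : I -> V) : Prop :=
  [/\ forall i, D i -> P (e i),
      forall (s : seq I) (c : I -> Phi), uniq s -> all D s ->
        \sum_(i <- s) c i *: e i = 0 -> forall i, i \in s -> c i = 0
    & forall u, P u ->
        exists (s : seq I) (c : I -> Phi),
          all D s /\ u = \sum_(i <- s) c i *: e i].

Section Heisenberg.
Variable Phi : fieldType.

(* The row vector (p, q, r) stands for p a + q b + r c. *)
Definition heis : Type := 'rV[Phi]_3.
HB.instance Definition _ := GRing.Lmodule.copy heis 'rV[Phi]_3.

Definition ia : 'I_3 := inord 0.
Definition ib : 'I_3 := inord 1.
Definition ic : 'I_3 := inord 2.

Definition heis_coord (x : heis) (i : 'I_3) : Phi := (x : 'rV[Phi]_3) ord0 i.

Definition heis_a : heis := delta_mx ord0 ia.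
Definition heis_b : heis := delta_mx ord0 ib.
Definition heis_c : heis := delta_mx ord0 ic.

(* The bilinear extension of b a = - a b = c. *)
Definition heis_mul (x y : heis) : heis :=
  (heis_coord x ib * heis_coord y ia - heis_coord x ia * heis_coord y ib)
    *: heis_c.

Lemma heis_coordP k (x y : heis) i :
  heis_coord (k *: x + y) i = k * heis_coord x i + heis_coord y i.
Proof. by rewrite /heis_coord !mxE. Qed.

Lemma heis_mul_linearl k (x y z : heis) :
  heis_mul (k *: x + y) z = k *: heis_mul x z + heis_mul y z.
Proof.
rewrite /heis_mul !heis_coordP scalerA -scalerDl; congr (_ *: _).
by rewrite !mulrDl opprD addrACA mulrBr !mulrA.
Qed.

Lemma heis_mul_linearr k (x y z : heis) :
  heis_mul z (k *: x + y) = k *: heis_mul z x + heis_mul z y.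
Proof.
rewrite /heis_mul !heis_coordP scalerA -scalerDl; congr (_ *: _).
by rewrite !mulrDr opprD addrACA mulrN !(mulrCA k).
Qed.

HB.instance Definition _ :=
  isNonAssocAlgebra.Build Phi heis heis_mul_linearl heis_mul_linearr.

(* The right action of the Heisenberg algebra on Phi[t]: f a = f', f b = t f,
   f c = f. *)
Definition heis_act (f : {poly Phi}) (x : heis) : {poly Phi} :=
  heis_coord x ia *: f^`() + heis_coord x ib *: ('X * f) + heis_coord x ic *: f.

Definition Htilde : Type := (heis * {poly Phi})%type.
HB.instance Definition _ := GRing.Lmodule.copy Htilde (heis * {poly Phi})%type.

(* (x + f)(y + g) = x y + f y *)
Definition Htilde_mul (u w : Htilde) : Htilde :=
  (u.1 ** w.1, heis_act u.2 w.1).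

Lemma Htilde_mul_linearl k (x y z : Htilde) :
  Htilde_mul (k *: x + y) z = k *: Htilde_mul x z + Htilde_mul y z.
Proof.
congr pair; first exact: namul_linearl.
rewrite /= /heis_act derivD derivZ mulrDr -scalerAr !scalerDr !scalerA.
by rewrite !(mulrC k) [RHS]addrACA; congr (_ + _); exact: addrACA.
Qed.

Lemma Htilde_mul_linearr k (x y z : Htilde) :
  Htilde_mul z (k *: x + y) = k *: Htilde_mul z x + Htilde_mul z y.
Proof.
congr pair; first exact: namul_linearr.
rewrite /= /heis_act !heis_coordP !scalerDl !scalerDr !scalerA.
by rewrite [RHS]addrACA; congr (_ + _); exact: addrACA.
Qed.

HB.instance Definition _ :=
  isNonAssocAlgebra.Build Phi Htilde Htilde_mul_linearl Htilde_mul_linearr.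

Lemma heis_coordE :
  ((heis_coord heis_a ia = 1) * (heis_coord heis_a ib = 0)
   * (heis_coord heis_a ic = 0) * (heis_coord heis_b ia = 0)
   * (heis_coord heis_b ib = 1) * (heis_coord heis_b ic = 0)
   * (heis_coord heis_c ia = 0) * (heis_coord heis_c ib = 0)
   * (heis_coord heis_c ic = 1))%type.
Proof. by rewrite /heis_coord !mxE -!val_eqE /= !inordK. Qed.

Lemma heis_mulE :
  [/\ heis_b ** heis_a = heis_c, heis_a ** heis_b = - heis_c,
      heis_a ** heis_a = 0, heis_b ** heis_b = 0
    & forall x : heis, x ** heis_c = 0 /\ heis_c ** x = 0].
Proof.
have mE (x y : heis) : x ** y = heis_mul x y by [].
split; rewrite ?mE /heis_mul ?heis_coordE.
- by rewrite mulr1 mulr0 subr0 scale1r.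
- by rewrite mulr0 mulr1 sub0r scaleN1r.
- by rewrite mul0r mulr0 subrr scale0r.
- by rewrite mul0r mulr0 subrr scale0r.
by move=> x; rewrite !mE /heis_mul !heis_coordE !mulr0 !mul0r subrr scale0r.
Qed.

Lemma heis_actE (f : {poly Phi}) :
  [/\ heis_act f heis_a = f^`(), heis_act f heis_b = 'X * f
    & heis_act f heis_c = f].
Proof. by rewrite /heis_act !heis_coordE !scale1r !scale0r !(addr0, add0r). Qed.

Lemma heis_coord_mul (x y : heis) :
  [/\ heis_coord (x ** y) ia = 0, heis_coord (x ** y) ib = 0
    & heis_coord (x ** y) ic = heis_coord x ib * heis_coord y ia
        - heis_coord x ia * heis_coord y ib].
Proof.
have mE : x ** y = heis_mul x y by [].
have cE k i : heis_coord (k *: heis_c) i = k * heis_coord heis_c i.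
  by rewrite /heis_coord mxE.
by rewrite mE /heis_mul !cE !heis_coordE !mulr0 mulr1.
Qed.

Lemma Htilde_leibniz : leibniz Htilde.
Proof.
move=> [x f] [y g] [z h]; congr pair.
  have mE (u w : heis) : u ** w = heis_mul u w by [].
  rewrite [LHS]mE [X in _ = X + _]mE [X in _ = _ + X]mE /heis_mul.
  have [-> -> _] := heis_coord_mul x y; have [-> -> _] := heis_coord_mul x z.
  have [-> -> _] := heis_coord_mul y z.
  by rewrite !(mul0r, mulr0) subrr !scale0r addr0.
rewrite -[LHS]/(heis_act (heis_act f y) z).
rewrite -[RHS]/(heis_act (heis_act f z) y + heis_act f (y ** z)).
rewrite {5}/heis_act; have [-> -> ->] := heis_coord_mul y z.
rewrite /heis_act !(derivD, derivZ, derivM, derivX) -!mul_polyC.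
rewrite !rmorphB !rmorphM /=; ring.
Qed.

End Heisenberg.

Definition V3tilde (Phi : fieldType) : naAlgType Phi -> Prop :=
  variety_gen (Htilde Phi).

(* Index data (i, [i_1..i_m], [j_1..j_m], [k_1..k_(n-2m-1)]); the generators
   being numbered from 0, the indices exhaust {0, ..., n-1}.  The equality of
   multisets forces pairwise distinctness, 2m+1 <= n and the number of k's. *)
Definition theta_index : eqType := (nat * seq nat * seq nat * seq nat)%type.

Definition theta_admissible (n : nat) (d : theta_index) : bool :=
  let: (i, si, sj, sk) := d in
  [&& size si == size sj, perm_eq (i :: si ++ sj ++ sk) (iota 0 n),
      all (fun p => (p.1 < p.2)%N) (zip si sj),
      sorted ltn si, sorted ltn sj & sorted ltn sk].

Definition theta (Phi : fieldType) (V : naAlgType Phi -> Prop)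
    (d : theta_index) : relfree V :=
  let: (i, si, sj, sk) := d in
  foldl (@namul Phi (relfree V)) (relgen V i)
    ([seq relgen V p.1 ** relgen V p.2 | p <- zip si sj]
       ++ [seq relgen V k | k <- sk]).

(* Main.v *)
(* In H~ the right multiplication by a product y z is a scalar operator, the
   skew bilinear bracket of y and z on the coordinates along a and b; it vanishes
   as soon as y or z is itself a product.

   Spanning: by these facts every multilinear monomial is zero or a word
   x_i (x_i1 x_j1) ... (x_im x_jm) x_k1 ... x_kr in which the pairs commute with
   all other factors.  The Leibniz identity u y z = u z y + u (y z) sorts the
   single letters at the cost of words with fewer of them, and the Pluecker
   relation for the bracket rewrites a nested pair of pairs p < q < r < s,
   (p s)(q r) = (p r)(q s) - (p q)(r s), which lowers the sum of the squared
   lengths of the pairs.  Once no pair is nested in another, sorting the pairs by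
   their first letters also sorts their second letters.

   Independence: given an admissible d = (i, I, J, K), put x_i := 1 in Phi[t],
   and a, b, c for the letters of I, J, K.  A word d' with a nonzero value at
   this point has first letter i and pairs each of which joins a letter of I to
   one of J.  Replacing the first letter of each such pair by its letter in I
   shows that the sum of k+1 over the first letters of d' is smaller than for d,
   unless d' = d. *)

Require Import Defs.
From HB Require Import structures.
From mathcomp Require Import all_boot all_order all_algebra.
From mathcomp Require Import ring zify finmap boolp.
From mathcomp.multinomials Require Import monalg.

Set Implicit Arguments.
Unset Strict Implicit.
Unset Printing Implicit Defensive.

Import GRing.Theory.
Local Open Scope ring_scope.

(** * Identities of the generating algebra *)

Record heisenberg_laws (Phi : fieldType) (A : naAlgType Phi) : Prop :=
  HeisenbergLaws {
  law_leibniz : leibniz A;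
  law_central : forall u y z w : A, u ** (y ** z) ** w = u ** w ** (y ** z);
  law_skew : forall u y z : A, u ** (y ** z) = - (u ** (z ** y));
  law_plucker : forall u p q r s : A,
    u ** (p ** s) ** (q ** r)
    = u ** (p ** r) ** (q ** s) - u ** (p ** q) ** (r ** s);
  law_nilr : forall u y z w : A, u ** (y ** (z ** w)) = 0;
  law_nill : forall u y z w : A, u ** (y ** z ** w) = 0
}.

Lemma heis_nilr (Phi : fieldType) (x y z : heis Phi) : x ** (y ** z) = 0.
Proof.
rewrite [LHS](_ : _ = heis_mul x (y ** z)) // /heis_mul.
by have [-> -> _] := heis_coord_mul y z; rewrite !mulr0 subrr scale0r.
Qed.

Lemma heis_nill (Phi : fieldType) (x y z : heis Phi) : x ** y ** z = 0.
Proof.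
rewrite [LHS](_ : _ = heis_mul (x ** y) z) // /heis_mul.
by have [-> -> _] := heis_coord_mul x y; rewrite !mul0r subrr scale0r.
Qed.

(** Up to sign, the 2 by 2 determinant of the coordinates along [a] and [b]. *)
Definition bracket (Phi : fieldType) (y z : heis Phi) : Phi :=
  heis_coord y ib * heis_coord z ia - heis_coord y ia * heis_coord z ib.

Lemma heis_act_mul (Phi : fieldType) (f : {poly Phi}) (y z : heis Phi) :
  heis_act f (y ** z) = bracket y z *: f.
Proof.
rewrite /heis_act /bracket; have [-> -> ->] := heis_coord_mul y z.
by rewrite !scale0r !add0r.
Qed.

Lemma heis_act0 (Phi : fieldType) (f : {poly Phi}) :
  heis_act f (0 : heis Phi) = 0.
Proof. by rewrite /heis_act /heis_coord !mxE !scale0r !addr0. Qed.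

Lemma heis_actZ (Phi : fieldType) k (f : {poly Phi}) (x : heis Phi) :
  heis_act (k *: f) x = k *: heis_act f x.
Proof.
rewrite /heis_act derivZ -scalerAr !scalerDr !scalerA.
by rewrite !(mulrC k).
Qed.

(** Triple products in the Heisenberg algebra vanish, which settles every component there. On
    polynomials a product acts by a determinant, whence skew symmetry and the three-term Plücker
    relation. *)
Lemma Htilde_laws (Phi : fieldType) : heisenberg_laws (Htilde Phi).
Proof.
have mE (u w : Htilde Phi) : u ** w = (u.1 ** w.1, heis_act u.2 w.1) by [].
split; first exact: Htilde_leibniz.
- move=> [u f] [y g] [z h] [w k]; rewrite !mE /=; congr pair.
    by rewrite !heis_nilr namul0l.
  by rewrite !heis_act_mul heis_actZ.
- move=> [u f] [y g] [z h]; rewrite !mE /=; congr pair.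
    by rewrite !heis_nilr oppr0.
  by rewrite !heis_act_mul -scaleNr; congr (_ *: _); rewrite /bracket; ring.
- move=> [u f] [p ?] [q ?] [r ?] [s ?]; rewrite !mE /=; congr pair.
    by rewrite /= !heis_nilr subrr.
  rewrite /= !heis_act_mul !scalerA -scalerBl /bracket.
  by congr (_ *: _); ring.
- move=> [u f] [y g] [z h] [w k]; rewrite !mE /=.
  by rewrite (heis_nilr y) namul0r heis_act0.
move=> [u f] [y g] [z h] [w k]; rewrite !mE /=.
by rewrite (heis_nill y) namul0r heis_act0.
Qed.

(** * Passage to the relatively free algebra *)

Section RelEval.
Variables (Phi : fieldType) (B : naAlgType Phi) (v : nat -> B).
Let F := relfree (variety_gen B).

Definition rel_eval (u : F) : B := na_eval v (relrepr u).

Lemma variety_gen_refl : variety_gen B B. Proof. by []. Qed.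

(** Two representatives of a class differ by an identity of the variety, which [B], itself a member,
    satisfies. *)
Lemma rel_eval_proj f : rel_eval (relproj (variety_gen B) f) = na_eval v f.
Proof.
apply/eqP; rewrite -subr_eq0 -linearB; apply/eqP.
have /relproj_eq := relreprK (relproj (variety_gen B) f).
by apply; exact: variety_gen_refl.
Qed.

Lemma rel_eval_linear : linear rel_eval.
Proof.
move=> k x y; rewrite -[x]relreprK -[y]relreprK -linearP !rel_eval_proj.
exact: linearP.
Qed.

HB.instance Definition _ :=
  GRing.isLinear.Build Phi F B *:%R rel_eval rel_eval_linear.

Lemma rel_evalM (x y : F) : rel_eval (x ** y) = rel_eval x ** rel_eval y.
Proof.
rewrite -[x in LHS]relreprK -[y in LHS]relreprK.
rewrite [_ ** _](_ : _ = relproj _ (relrepr x ** relrepr y)); last first.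
  by rewrite relprojM.
by rewrite rel_eval_proj na_evalM.
Qed.

End RelEval.

(** Whatever vanishes at all points of [B] is an identity of the variety that [B] generates. *)
Lemma rel_eval_inj (Phi : fieldType) (B : naAlgType Phi)
    (x y : relfree (variety_gen B)) :
  (forall v : nat -> B, rel_eval v x = rel_eval v y) -> x = y.
Proof.
move=> eqxy; rewrite -[x]relreprK -[y]relreprK; apply/relproj_eq => A VA.
by apply: VA => v; rewrite linearB /= -!rel_eval_proj !relreprK eqxy subrr.
Qed.

(* Stated for an abstract A: with A replaced by relfree, rewriting with the
   linearity of h v unfolds the quotient and does not terminate. *)
Lemma laws_separated (Phi : fieldType) (A B : naAlgType Phi) (T : Type)
    (h : T -> {linear A -> B}) :
    (forall v x y, h v (x ** y) = h v x ** h v y) ->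
    (forall x y, (forall v, h v x = h v y) -> x = y) ->
  heisenberg_laws B -> heisenberg_laws A.
Proof.
move=> hM hI [l1 l2 l3 l4 l5 l6].
split=> [x y z|u y z w|u y z|u p q r s|u y z w|u y z w]; apply: hI => v;
  rewrite ?(linearD, linearN, linear0) /= !hM.
- exact: l1.
- exact: l2.
- exact: l3.
- exact: l4.
- exact: l5.
- exact: l6.
Qed.

Lemma relfree_laws (Phi : fieldType) (B : naAlgType Phi) :
  heisenberg_laws B -> heisenberg_laws (relfree (variety_gen B)).
Proof.
apply: (@laws_separated _ _ _ _ (fun v : nat -> B => @rel_eval _ _ v)).
  exact: rel_evalM.
exact: rel_eval_inj.
Qed.

Lemma mon_eval_relgen (Phi : fieldType) (V : naAlgType Phi -> Prop) t :
  mon_eval (relgen V) t = relproj V << t >>.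
Proof.
elim: t => //= t1 -> t2 ->; rewrite -[_ ** _]relprojM; congr relproj.
by rewrite [_ ** _]/(freeNA_mul _ _) /freeNA_mul !lin_extU.
Qed.

(** * Linear spans *)

Section Span.
Variables (Phi : fieldType) (V : lmodType Phi) (I : eqType) (D : pred I).
Variable e : I -> V.
Implicit Types u w : V.

(** Indices may repeat in the list, which makes closure under sums mere concatenation. *)
Definition in_span u : Prop :=
  exists2 l : seq (Phi * I), all (fun p => D p.2) l
    & u = \sum_(p <- l) p.1 *: e p.2.

Lemma in_span0 : in_span 0.
Proof. by exists [::]; rewrite ?big_nil. Qed.

Lemma in_spanD u w : in_span u -> in_span w -> in_span (u + w).
Proof.
move=> [l Dl ->] [l' Dl' ->]; exists (l ++ l'); first by rewrite all_cat Dl.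
by rewrite big_cat.
Qed.

Lemma in_spanZ k u : in_span u -> in_span (k *: u).
Proof.
move=> [l Dl ->]; exists [seq (k * p.1, p.2) | p <- l].
  by rewrite all_map; apply: sub_all Dl.
by rewrite big_map scaler_sumr; apply: eq_bigr => p _; rewrite scalerA.
Qed.

Lemma in_spanN u : in_span u -> in_span (- u).
Proof. by rewrite -scaleN1r; exact: in_spanZ. Qed.

Lemma in_span_gen i : D i -> in_span (e i).
Proof.
by move=> Di; exists [:: (1, i)]; rewrite /= ?Di // big_seq1 scale1r.
Qed.

(** A coefficient function has one value per index, so repeated indices are merged and their
    coefficients added. *)
Lemma in_spanP u : in_span u ->
  exists (s : seq I) (c : I -> Phi), all D s /\ u = \sum_(i <- s) c i *: e i.
Proof.
move=> [l Dl ->]; exists (undup [seq p.2 | p <- l]).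
exists (fun i => \sum_(p <- l | p.2 == i) p.1); split.
  apply/allP => i; rewrite mem_undup => /mapP [p pl ->].
  exact: (allP Dl).
(* Padding with zero terms lets the two sums be exchanged; for each [p] only the index [p.2]
   survives. *)
transitivity (\sum_(i <- undup [seq p.2 | p <- l])
    \sum_(p <- l) if p.2 == i then p.1 *: e p.2 else 0).
  rewrite exchange_big /= big_seq [RHS]big_seq; apply: eq_bigr => p pl.
  rewrite (bigD1_seq p.2) ?undup_uniq //= ?mem_undup ?map_f //.
  by rewrite eqxx big1 ?addr0 // => i; rewrite eq_sym => /negPf ->.
apply: eq_bigr => i _; rewrite scaler_suml [RHS]big_mkcond.
by apply: eq_bigr => p _; case: eqP => // ->.
Qed.

End Span.

(** * Left-normed words *)

Section LeftNormed.
Variables (Phi : fieldType) (A : naAlgType Phi) (lawsA : heisenberg_laws A).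
Variable x : nat -> A.
Implicit Types (u : A) (P : seq (nat * nat)) (K : seq nat).

Definition mul_pairs u P : A :=
  foldl (fun w p => w ** (x p.1 ** x p.2)) u P.

Definition mul_gens u K : A := foldl (fun w k => w ** x k) u K.

Definition word (i : nat) P K : A := mul_gens (mul_pairs (x i) P) K.

Lemma mul_gensD u w K : mul_gens (u + w) K = mul_gens u K + mul_gens w K.
Proof. by elim: K u w => //= p P IHP u w; rewrite namulDl IHP. Qed.

Lemma mul_pairsC u P y z :
  mul_pairs u P ** (y ** z) = mul_pairs (u ** (y ** z)) P.
Proof.
by elim: P u => //= p P IHP u; rewrite IHP (law_central lawsA u y).
Qed.

Lemma mul_gensC u K y z :
  mul_gens u K ** (y ** z) = mul_gens (u ** (y ** z)) K.
Proof.
by elim: K u => //= p P IHP u; rewrite IHP (law_central lawsA u y).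
Qed.

Lemma mul_pairs_cat u P P' :
  mul_pairs u (P ++ P') = mul_pairs (mul_pairs u P) P'.
Proof. exact: foldl_cat. Qed.

Lemma mul_gens_cat u K K' : mul_gens u (K ++ K') = mul_gens (mul_gens u K) K'.
Proof. exact: foldl_cat. Qed.

Lemma mul_pairs_perm u P P' : perm_eq P P' -> mul_pairs u P = mul_pairs u P'.
Proof.
elim: P P' u => [|p P IHP] P' u; first by rewrite perm_sym => /perm_nilP ->.
move=> ePP; have pP : p \in P' by rewrite -(perm_mem ePP) mem_head.
move: ePP; case/splitPr: pP => P1 P2 ePP.
have /IHP IH : perm_eq P (P1 ++ P2).
  rewrite -(perm_cons p) (permPl ePP).
  by rewrite (perm_catCA P1 [:: p]).
by rewrite [LHS]/= IH !mul_pairs_cat /= mul_pairsC.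
Qed.

Lemma word_perm i P P' K : perm_eq P P' -> word i P K = word i P' K.
Proof. by rewrite /word => /mul_pairs_perm ->. Qed.

Lemma word_rcons i P K k : word i P (rcons K k) = word i P K ** x k.
Proof. by rewrite /word /mul_gens foldl_rcons. Qed.

(** Centrality carries a pair from the innermost place to the outermost one, where the laws apply
    directly. *)
Lemma word_consp i P K p : word i (p :: P) K = word i P K ** (x p.1 ** x p.2).
Proof. by rewrite /word mul_gensC mul_pairsC. Qed.

Lemma word_plucker i p q r s P K :
  word i [:: (p, s), (q, r) & P] K =
  word i [:: (p, r), (q, s) & P] K - word i [:: (p, q), (r, s) & P] K.
Proof.
rewrite !word_consp /=.
(* The head pair of the list is now outermost, so the two products are exchanged to match
   [law_plucker]. *)
rewrite ![_ ** (x q ** x _) ** _](law_central lawsA).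
by rewrite [_ ** (x r ** x s) ** _](law_central lawsA) (law_plucker lawsA).
Qed.

(** The Leibniz identity is applied right after [K]; the new product then moves back among the
    pairs. *)
Lemma word_swap i P K y z K' :
  word i P (K ++ [:: y, z & K']) =
  word i P (K ++ [:: z, y & K']) + word i ((y, z) :: P) (K ++ K').
Proof.
rewrite /word !mul_gens_cat /= -mul_gensD; congr mul_gens.
by rewrite (law_leibniz lawsA) mul_gensC mul_pairsC.
Qed.

Definition pair_letters P : seq nat := flatten [seq [:: p.1; p.2] | p <- P].

Definition word_letters (i : nat) P K : seq nat := i :: pair_letters P ++ K.

Lemma pair_letters_unzip P : perm_eq (pair_letters P) (unzip1 P ++ unzip2 P).
Proof.
elim: P => //= p P IHP.
rewrite perm_cons perm_sym.
rewrite (perm_catCA (unzip1 P) [:: p.2]) perm_cons perm_sym.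
exact: IHP.
Qed.

(** Induction on the left factor only: a right factor is a letter, a product of two letters, or is
    annihilated by a nil law. *)
Lemma mon_eval_word t :
  mon_eval x t = 0 \/
  exists i P K, mon_eval x t = word i P K
    /\ perm_eq (leaves t) (word_letters i P K).
Proof.
elim: t => [k|t1 IH1 t2 _]; first by right; exists k, [::], [::]; split.
case: IH1 => [/= ->|[i [P [K [/= -> lE]]]]].
  by left; rewrite namul0l.
case: t2 => [k|[j|t t'] [k|t'' t3]] /=.
- right; exists i, P, (rcons K k); rewrite word_rcons; split=> //.
  rewrite /word_letters -cats1 catA -[i :: _]/((i :: _ ++ _) ++ [:: k]).
  by rewrite perm_cat2r.
- right; exists i, ((j, k) :: P), K; rewrite word_consp; split=> //.
  rewrite /word_letters /=.
  rewrite perm_catC perm_sym.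
  rewrite (perm_catCA [:: i] [:: j; k]) perm_cat2l perm_sym.
  exact: lE.
- by left; rewrite (law_nilr lawsA).
- by left; rewrite (law_nill lawsA).
- by left; rewrite (law_nilr lawsA).
Qed.

End LeftNormed.

(* Each letter is weighted by the number of letters following it, so that
   moving the smaller of two adjacent letters to the front lowers the sum. *)
Fixpoint disorder (K : seq nat) : nat :=
  if K is k :: K' then (k * size K' + disorder K')%N else 0%N.

(** The sum drops by [y - z]; the letters of [K] keep their weights. *)
Lemma disorder_swap K y z K' : (z < y)%N ->
  (disorder (K ++ [:: z, y & K']) < disorder (K ++ [:: y, z & K']))%N.
Proof.
move=> zy; elim: K => [|k K IHK] /=; first by nia.
by rewrite !size_cat /=; lia.
Qed.

Lemma descent K : ~~ sorted ltn K ->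
  exists K1 y z K2, K = K1 ++ [:: y, z & K2] /\ (z <= y)%N.
Proof.
elim: K => // y [|z K] // IHK; rewrite [sorted _ _]/= negb_and.
case/orP => [yz|/IHK [K1 [y' [z' [K2 [-> zy]]]]]].
  by exists [::], y, z, K; rewrite leqNgt.
by exists (y :: K1), y', z', K2.
Qed.

Definition orient (p : nat * nat) : nat * nat :=
  if (p.1 < p.2)%N then p else (p.2, p.1).

Definition oriented (p : nat * nat) : bool := (p.1 < p.2)%N.

Definition nested (p q : nat * nat) : bool := (p.1 < q.1)%N && (q.2 < p.2)%N.

(** Squares matter: replacing [(p s)(q r)] by [(p r)(q s)] preserves the plain sum of lengths. *)
Definition spread (P : seq (nat * nat)) : nat :=
  (\sum_(p <- P) (p.2 - p.1) ^ 2)%N.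

Lemma pair_letters_perm P P' :
  perm_eq P P' -> perm_eq (pair_letters P) (pair_letters P').
Proof. by move=> ePP; apply/perm_flatten/perm_map. Qed.

Lemma word_letters_perm i P P' K : perm_eq P P' ->
  perm_eq (word_letters i P K) (word_letters i P' K).
Proof.
by move=> ePP; rewrite perm_cons perm_cat2r; exact: pair_letters_perm.
Qed.

(** * Spanning by rewriting to normal form *)

Section Spanning.
Variables (Phi : fieldType) (A : naAlgType Phi) (lawsA : heisenberg_laws A).
Variables (x : nat -> A) (n : nat).

(** Taken at an arbitrary point [x], so that it serves both for the free generators and for
    evaluations. *)
Definition theta_word (d : theta_index) : A :=
  let: (i, si, sj, sk) := d in word x i (zip si sj) sk.

Notation spanned := (in_span (theta_admissible n) theta_word).

Lemma spanned_unnested i P K :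
    all oriented P -> ~~ has (fun p => has (nested p) P) P -> sorted ltn K ->
    perm_eq (word_letters i P K) (iota 0 n) ->
  spanned (word x i P K).
Proof.
move=> oP nP sK lP; pose le1 (p q : nat * nat) := (p.1 <= q.1)%N.
pose Q := sort le1 P; have ePQ : perm_eq P Q by rewrite perm_sym perm_sort.
have le1_trans : transitive le1 by move=> p q r; exact: leq_trans.
have sQ : pairwise le1 Q.
  by rewrite -sorted_pairwise // sort_sorted // => p q; exact: leq_total.
have lQ : perm_eq (i :: unzip1 Q ++ unzip2 Q ++ K) (iota 0 n).
  apply: perm_trans lP; rewrite perm_sym (permPl (word_letters_perm i K ePQ)).
  by rewrite perm_cons catA perm_cat2r pair_letters_unzip.
have uQ : uniq (unzip1 Q ++ unzip2 Q ++ K).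
  by have := perm_uniq lQ; rewrite iota_uniq /= => /andP [].
(* Sorting yields a weak order; distinctness of the letters makes it strict. *)
have sQ1 : sorted ltn (unzip1 Q).
  rewrite ltn_sorted_uniq_leq; apply/andP; split.
    by move: uQ; rewrite cat_uniq => /andP [].
  by rewrite (sorted_pairwise leq_trans) pairwise_map.
rewrite (word_perm lawsA x i K ePQ) -[Q]zip_unzip.
apply: (in_span_gen _ (i := (i, unzip1 Q, unzip2 Q, K))); apply/and5P; split.
- by rewrite !size_map.
- exact: lQ.
- by rewrite zip_unzip (eq_all (a2 := oriented)) // -(perm_all _ ePQ).
- exact: sQ1.
rewrite sK andbT ltn_sorted_uniq_leq; apply/andP; split.
  by move: uQ; rewrite catA cat_uniq cat_uniq => /andP [/and3P []].
move: sQ1; rewrite (sorted_pairwise ltn_trans) (sorted_pairwise leq_trans).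
(* A decrease of second letters along [Q] would exhibit a nested pair. *)
rewrite !pairwise_map; apply: sub_in_pairwise (allss Q) => p q pQ qQ /= pq.
rewrite leqNgt; apply: contra nP => qp.
apply/hasP; exists p; first by rewrite (perm_mem ePQ).
by apply/hasP; exists q; rewrite ?(perm_mem ePQ) // /nested pq.
Qed.

Lemma spanned_oriented i P K :
    all oriented P -> sorted ltn K ->
    perm_eq (word_letters i P K) (iota 0 n) ->
  spanned (word x i P K).
Proof.
move=> + sK; have [m] := ubnP (spread P); elim: m P => // m IHm P Pm oP lP.
have [|nP] := boolP (has (fun p => has (nested p) P) P); last first.
  exact: spanned_unnested.
case/hasP => -[p s] pP /hasP [[q r]] qP /andP [/= pq rs].
have {}ePP : perm_eq P [:: (p, s), (q, r) & rem (q, r) (rem (p, s) P)].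
  rewrite (permPl (perm_to_rem pP)) perm_cons perm_to_rem // rem_mem //.
  by apply: contraTneq pq => -[->]; rewrite ltnn.
move: (rem _ _) ePP => P' ePP.
move: oP; rewrite (perm_all _ ePP) => /and3P [ps qr oP'].
rewrite /oriented /= in ps qr.
have {}lP := perm_trans (word_letters_perm i K (etrans (perm_sym _ _) ePP)) lP.
have {}Pm : ((s - p) ^ 2 + ((r - q) ^ 2 + spread P') < m.+1)%N.
  by move: Pm; rewrite /spread (perm_big _ ePP) !big_cons.
rewrite (word_perm lawsA x i K ePP) (word_plucker lawsA).
apply: in_spanD; last apply: in_spanN; apply: IHm.
- by rewrite /spread !big_cons -/(spread P') /=; nia.
- by apply/and3P; split; rewrite // /oriented /=; lia.
(* Multisets are compared by counting under every predicate, which reduces to linear arithmetic. *)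
- by apply/permP => f; have/permP/(_ f) := lP; rewrite /=; lia.
- by rewrite /spread !big_cons -/(spread P') /=; nia.
- by apply/and3P; split; rewrite // /oriented /=; lia.
- by apply/permP => f; have/permP/(_ f) := lP; rewrite /=; lia.
Qed.

(** The scalar is a sign, one factor -1 for each pair reversed. *)
Lemma word_orient i P K :
  exists k : Phi, word x i P K = k *: word x i [seq orient p | p <- P] K.
Proof.
elim: P => [|p P [k IHP]]; first by exists 1; rewrite scale1r.
rewrite /= !(word_consp lawsA) IHP namulZl /orient.
case: ifP => _; first by exists k.
by exists (- k); rewrite (law_skew lawsA) scalerN scaleNr.
Qed.

Lemma spanned_sorted i P K : sorted ltn K ->
  perm_eq (word_letters i P K) (iota 0 n) -> spanned (word x i P K).
Proof.
move=> sK lP; have [k ->] := word_orient i P K; apply: in_spanZ.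
have uP : uniq (pair_letters P ++ K).
  by have := perm_uniq lP; rewrite iota_uniq /= => /andP [].
apply: spanned_oriented => //.
  rewrite all_map; apply/allP => p pP /=; rewrite /orient /oriented.
  (* [orient] fails only on a pair of equal letters, which multilinearity excludes. *)
  case: (ltngtP p.1 p.2) => //= pp; exfalso; move: uP.
  rewrite cat_uniq.
  by rewrite (perm_uniq (pair_letters_perm (perm_to_rem pP))) /= pp inE eqxx.
apply: perm_trans lP; rewrite perm_cons perm_cat2r /pair_letters.
elim: P {uP} => // p P IHP; rewrite /= [orient p]/orient; case: ifP => _ /=.
  by rewrite !perm_cons.
by apply/permP => f; have/permP/(_ f) := IHP; rewrite /=; lia.
Qed.

(** Lexicographic induction on the size and the disorder of [K]: a swap keeps the size and lowers
    the disorder, while the extra word has two single letters fewer. *)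
Lemma spanned_word i P K :
  perm_eq (word_letters i P K) (iota 0 n) -> spanned (word x i P K).
Proof.
have [m] := ubnP (size K); elim: m P K => // m IHm P K.
have [w] := ubnP (disorder K); elim: w K => // w IHw K Kw Km lK.
have [|/descent [K1 [y [z [K2 [eK zy]]]]]] := boolP (sorted ltn K).
  by move=> sK; exact: spanned_sorted.
rewrite {K}eK in Kw Km lK *.
have {}zy : (z < y)%N.
  rewrite ltn_neqAle zy andbT; apply: contraTneq (iota_uniq 0 n) => zy'.
  by rewrite -(perm_uniq lK) zy' /= catA cat_uniq /= inE eqxx !andbF.
rewrite (word_swap lawsA); apply: in_spanD.
  apply: IHw; first by have := disorder_swap K1 K2 zy; lia.
    by move: Km; rewrite !size_cat.
  apply/permP => f; have/permP/(_ f) := lK.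
  by rewrite /= !count_cat /=; lia.
apply: IHm; first by move: Km; rewrite !size_cat /=; lia.
apply/permP => f; have/permP/(_ f) := lK.
by rewrite /= -/(pair_letters P) !count_cat /=; lia.
Qed.

Lemma spanned_mon t : multilinear_mon n t -> spanned (mon_eval x t).
Proof.
move=> tn; have [->|[i [P [K [-> lE]]]]] := mon_eval_word lawsA x t.
  exact: in_span0.
by apply: spanned_word; rewrite -(permPl lE).
Qed.

End Spanning.

(* The successor makes the weight of a proper subset strictly smaller, even when
   only the letter 0 is missing. *)
Definition weight (s : seq nat) : nat := (\sum_(k <- s) k.+1)%N.

(** * Triangularity of the index data *)

Lemma uniq_pair_choice (phi : nat * nat -> nat) (P : seq (nat * nat)) :
  (forall p, phi p \in [:: p.1; p.2]) -> uniq (pair_letters P) ->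
  uniq (map phi P).
Proof.
move=> phiP; elim: P => // p P IHP.
rewrite -[pair_letters (p :: P)]/([:: p.1; p.2] ++ pair_letters P) cat_uniq.
move=> /and3P [_ /hasPn dP uP] /=; rewrite IHP // andbT.
apply/mapP => -[q qP eqpq]; have := phiP p; rewrite eqpq; apply/negP/dP.
by apply/flattenP; exists [:: q.1; q.2]; rewrite ?phiP // map_f.
Qed.

Lemma theta_admissible_uniq n i si sj sk :
  theta_admissible n (i, si, sj, sk) -> uniq (i :: si ++ sj ++ sk).
Proof. by case/and5P => _ pn _ _ _; rewrite (perm_uniq pn) iota_uniq. Qed.

Definition matched (si sj : seq nat) (p : nat * nat) : bool :=
  (p.1 \in si) && (p.2 \in sj) || (p.1 \in sj) && (p.2 \in si).

(** The letters [phi p] are distinct members of [si] with [p.1 <= phi p], which bounds the weight.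
    Equality forces [phi p = p.1] throughout and leaves no letter of [si] over; sortedness then
    recovers each list from its set. *)
Lemma theta_triangular n i si sj sk si' sj' sk' :
    theta_admissible n (i, si, sj, sk) ->
    theta_admissible n (i, si', sj', sk') ->
    all (matched si sj) (zip si' sj') ->
  (weight si' < weight si)%N \/ (i, si', sj', sk') = (i, si, sj, sk).
Proof.
move=> ad ad' mP; have /= /andP [_ ud] := theta_admissible_uniq ad.
have /= /andP [_ ud'] := theta_admissible_uniq ad'.
case/and5P: ad => /eqP szd pd _ ssi /andP [ssj ssk].
case/and5P: ad' => /eqP szd' pd' lt' ssi' /andP [ssj' ssk'].
set P := zip si' sj' in mP lt'.
have P1 : unzip1 P = si' by rewrite unzip1_zip ?szd'.
have P2 : unzip2 P = sj' by rewrite unzip2_zip ?szd'.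
have dij k : k \in si -> k \notin sj.
  move: ud; rewrite catA cat_uniq cat_uniq.
  move=> /and3P [/and3P [_ /hasPn H _] _ _].
  by apply: contraL => /H.
pose phi p := if p.1 \in si then p.1 else p.2; pose L := map phi P.
have phisi p : p \in P -> phi p \in si.
  by move/(allP mP); rewrite /matched /phi; case: ifP => //= _ /andP [].
have uL : uniq L.
  apply: uniq_pair_choice => [p|].
    by rewrite /phi !inE; case: ifP; rewrite eqxx ?orbT.
  rewrite (perm_uniq (pair_letters_unzip P)) P1 P2.
  by move: ud'; rewrite catA cat_uniq => /andP [].
have usi : uniq si by move: ud; rewrite cat_uniq => /andP [].
pose rest := [seq k <- si | k \notin L].
have psi : perm_eq (L ++ rest) si.
  rewrite perm_sym -(perm_filterC (mem L) si) perm_cat2r perm_sym.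
  apply: uniq_perm; rewrite ?filter_uniq // => k; rewrite mem_filter /=.
  rewrite andb_idr // => /mapP [p pP ->]; exact: phisi.
have ltP p : p \in P -> (p.1 <= phi p)%N.
  by move/(allP lt') => pp; rewrite /phi; case: ifP => // _; exact: ltnW.
have wE : weight si =
    (weight si' + \sum_(p <- P) (phi p - p.1) + weight rest)%N.
  rewrite /weight -(perm_big _ psi) big_cat /= -P1 !big_map -big_split /=.
  congr addn; rewrite big_seq [RHS]big_seq; apply: eq_bigr => p pP.
  by rewrite addSn subnKC // ltP.
case: (ltnP (weight si') (weight si)) => [|le_w]; [by left | right].
rewrite wE -addnA -[X in (_ <= X)%N]addn0 leq_add2l leqn0 addn_eq0 in le_w.
case/andP: le_w; rewrite !sum_nat_seq_eq0 => /allP phi0 rest0.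
have {}rest0 : rest = [::] by case: (rest) rest0.
have LE : L = si'.
  rewrite -P1; apply/eq_in_map => p pP; apply/eqP.
  by rewrite eqn_leq ltP // andbT -subn_eq0; exact: phi0.
rewrite rest0 cats0 LE in psi.
have irr s s' : sorted ltn s -> sorted ltn s' -> s =i s' -> s = s'.
  by apply: irr_sorted_eq; [exact: ltn_trans | exact: ltnn].
have esi : si' = si by apply: irr => //; exact: perm_mem.
have esj : sj' = sj.
  (* First letters now lie in [si], hence second letters in [sj]; inclusion with equal sizes gives
     equality. *)
  apply: irr => //; apply uniq_min_size.
  - by move: ud'; rewrite catA cat_uniq cat_uniq => /andP [/and3P []].
  - rewrite -P2 => _ /mapP [p pP ->].
    have p1 : p.1 \in si by rewrite -esi -P1 map_f.
    by have := allP mP p pP; rewrite /matched p1 (negPf (dij _ p1)) orbF.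
  by rewrite -szd -szd' esi.
rewrite esi esj; congr (_, _, _, _); apply: irr => //; apply: perm_mem.
have := perm_trans pd' (etrans (perm_sym _ _) pd).
by rewrite esi esj perm_cons !perm_cat2l.
Qed.

(** * Evaluation at a probe point *)

Section Probe.
Variable Phi : fieldType.
Implicit Types (v : nat -> Htilde Phi) (P : seq (nat * nat)) (K : seq nat).

Lemma mul_pairs_snd v u P :
  (mul_pairs v u P).2 =
  (\prod_(p <- P) bracket (v p.1).1 (v p.2).1) *: u.2.
Proof.
elim: P u => [|p P IHP] u; first by rewrite big_nil scale1r.
rewrite [LHS]IHP big_cons mulrC -scalerA; congr (_ *: _).
exact: heis_act_mul.
Qed.

Lemma mul_gens_snd v u K :
  (mul_gens v u K).2 = foldl (fun f k => heis_act f (v k).1) u.2 K.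
Proof. by elim: K u => //= k K IHK u; rewrite IHK. Qed.

Lemma mul_gens_snd0 v u K : u.2 = 0 -> (mul_gens v u K).2 = 0.
Proof.
rewrite mul_gens_snd => ->; elim: K => //= k K.
by rewrite /heis_act linear0 mulr0 !scaler0 !addr0.
Qed.

Lemma mul_gens_snd_c v u K : (forall k, k \in K -> (v k).1 = heis_c Phi) ->
  (mul_gens v u K).2 = u.2.
Proof.
rewrite mul_gens_snd; elim: K u.2 => //= k K IHK f vc.
rewrite vc ?mem_head //; have [_ _ ->] := heis_actE f.
by apply: IHK => j jK; rewrite vc // in_cons jK orbT.
Qed.

(** The default [c] acts as the identity on polynomials and has zero bracket with everything. *)
Definition probe (d : theta_index) (k : nat) : Htilde Phi :=
  let: (i, si, sj, _) := d in
  if k == i then (0, 1) else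
  if k \in si then (heis_a Phi, 0) else
  if k \in sj then (heis_b Phi, 0) else (heis_c Phi, 0).

Lemma probe_matched i si sj sk p :
  bracket (probe (i, si, sj, sk) p.1).1 (probe (i, si, sj, sk) p.2).1 != 0 ->
  matched si sj p.
Proof.
have c0 j : heis_coord (0 : heis Phi) j = 0 by rewrite /heis_coord mxE.
rewrite /bracket /matched /probe; case: (_ == i).
  by rewrite !c0 !mul0r subrr eqxx.
case: (_ == i) => /=; first by rewrite !c0 !mulr0 subrr eqxx.
case: (p.1 \in si); case: (p.2 \in si); case: (p.1 \in sj);
  case: (p.2 \in sj);
  by rewrite //= !heis_coordE ?(mulr0, mul0r, mulr1) subrr eqxx.
Qed.

(** Only the letter [i] has a polynomial component, so it must come first, and every bracket factor
    must be nonzero. The projection [d.1.1.2] is the list [si]. *)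
Lemma theta_word_probe0 n d d' :
    theta_admissible n d -> theta_admissible n d' ->
    (theta_word (probe d) d').2 != 0 ->
  (weight d'.1.1.2 < weight d.1.1.2)%N \/ d' = d.
Proof.
case: d d' => [[[i si] sj] sk] [[[i' si'] sj'] sk'] ad ad' nz.
have nzP : (mul_pairs (probe (i, si, sj, sk)) (probe (i, si, sj, sk) i')
              (zip si' sj')).2 != 0.
  by apply: contraNneq nz => z; rewrite [X in X.2]/= /word mul_gens_snd0.
rewrite mul_pairs_snd scaler_eq0 negb_or in nzP.
case/andP: nzP => prod_nz i'_nz.
have ei : i' = i.
  apply: contraNeq i'_nz; rewrite /probe => /negPf ->.
  by case: ifP => _; [|case: ifP].
rewrite {}ei in ad' *; apply: theta_triangular ad ad' _.
apply/allP => p pP; apply: (@probe_matched i _ _ sk).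
by apply: contraNneq prod_nz => z; rewrite (big_rem p) //= z mul0r.
Qed.

(** Each pair contributes the bracket of [a] with [b], which is -1, and the single letters act as
    the identity. *)
Lemma theta_word_probe_diag n d :
  theta_admissible n d -> (theta_word (probe d) d).2 != 0.
Proof.
case: d => [[[i si] sj] sk] ad; have := theta_admissible_uniq ad.
case/and5P: ad => /eqP szd _ _ _ _ /= /andP [ni].
rewrite !cat_uniq => /and3P [_ /hasPn dis /and3P [_ /hasPn djk _]].
rewrite !mem_cat !negb_or in ni; case/and3P: ni => nii nij nik.
have aI k : k \in si -> (probe (i, si, sj, sk) k).1 = heis_a Phi.
  by move=> ksi; rewrite /probe ksi ifN //; apply: contraNneq nii => <-.
have bJ k : k \in sj -> (probe (i, si, sj, sk) k).1 = heis_b Phi.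
  move=> ksj; rewrite /probe ksj ifN; last by apply: contraNneq nij => <-.
  by rewrite ifN //; apply: dis; rewrite mem_cat ksj.
have cK k : k \in sk -> (probe (i, si, sj, sk) k).1 = heis_c Phi.
  move=> ksk; rewrite /probe ifN; last by apply: contraNneq nik => <-.
  by rewrite !ifN ?djk //; apply: dis; rewrite mem_cat ksk orbT.
rewrite /word mul_gens_snd_c // mul_pairs_snd.
rewrite [probe _ i]/probe eqxx scaler_eq0 oner_eq0 orbF.
rewrite prodf_seq_neq0; apply/allP => p pP /=.
have /andP [p1 p2] : (p.1 \in si) && (p.2 \in sj).
  rewrite -{1}(unzip1_zip (s := si) (t := sj)) ?szd // map_f //=.
  by rewrite -(unzip2_zip (s := si) (t := sj)) ?szd // map_f.
rewrite (aI _ p1) (bJ _ p2) /bracket !heis_coordE mulr0 mulr1 sub0r.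
by rewrite oppr_eq0 oner_eq0.
Qed.

End Probe.

(** * Theta elements as classes of multilinear monomials *)

Section ThetaWord.
Variables (Phi : fieldType) (V : naAlgType Phi -> Prop).

Lemma theta_is_word d : theta V d = theta_word (relgen V) d.
Proof.
case: d => [[[i si] sj] sk].
have foldl_map (T : Type) (F : T -> relfree V) r u :
    foldl (@namul Phi _) u [seq F y | y <- r] = foldl (fun w y => w ** F y) u r.
  by elim: r u => /=.
by rewrite /theta foldl_cat !foldl_map.
Qed.

Definition word_mon (d : theta_index) : namon :=
  let: (i, si, sj, sk) := d in
  foldl (fun t k => NMul t (NVar k))
    (foldl (fun t p => NMul t (NMul (NVar p.1) (NVar p.2))) (NVar i)
       (zip si sj)) sk.

Lemma mon_eval_word_mon (A : naAlgType Phi) (x : nat -> A) d :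
  mon_eval x (word_mon d) = theta_word x d.
Proof.
case: d => [[[i si] sj] sk] /=; rewrite /word.
(* The start of the fold is exposed as a monomial so that the induction can generalize it. *)
rewrite -[x i]/(mon_eval x (NVar i)).
elim: (zip si sj) (NVar i) => [|p P IHP] t /=; last exact: IHP.
by elim: sk t => //= k K IHK t; rewrite -IHK.
Qed.

Lemma leaves_word_mon i si sj sk :
  leaves (word_mon (i, si, sj, sk)) = word_letters i (zip si sj) sk.
Proof.
rewrite /word_letters /= -cat1s -[[:: i]]/(leaves (NVar i)).
elim: (zip si sj) (NVar i) => [|p P IHP] t /=; last by rewrite IHP /= -catA.
elim: sk t => [|k K IHK] t /=; first by rewrite cats0.
by rewrite IHK /= -catA.
Qed.

Lemma theta_multilinear n d :
  theta_admissible n d -> multilinear_part n (theta V d).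
Proof.
move=> ad; exists << word_mon d >>; split; last first.
  by rewrite theta_is_word -mon_eval_word_mon mon_eval_relgen.
move=> t; rewrite msuppU oner_eq0 inE => /eqP ->.
case: d ad => [[[i si] sj] sk] /and5P [/eqP szd pd _ _ _].
rewrite /multilinear_mon leaves_word_mon; apply: perm_trans pd.
rewrite perm_cons catA perm_cat2r (permPl (pair_letters_unzip _)).
by rewrite unzip1_zip ?unzip2_zip ?szd.
Qed.

End ThetaWord.

(** * Linear independence and the basis *)

Lemma rel_eval_theta (Phi : fieldType) (B : naAlgType Phi) (v : nat -> B)
    (s : seq theta_index) (c : theta_index -> Phi) :
  rel_eval v (\sum_(d <- s) c d *: theta (variety_gen B) d) =
  \sum_(d <- s) c d *: theta_word v d.
Proof.
rewrite linear_sum; apply: eq_bigr => d _; rewrite linearZ /=; congr (_ *: _).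
rewrite theta_is_word -mon_eval_word_mon mon_eval_relgen rel_eval_proj.
by rewrite /na_eval lin_extU mon_eval_word_mon.
Qed.

(** Strong induction on the weight of [d]: at the probe of [d], any other term with nonzero value
    has smaller weight, so its coefficient is already zero. *)
Lemma theta_free (Phi : fieldType) (n : nat) (s : seq theta_index)
    (c : theta_index -> Phi) :
    uniq s -> all (theta_admissible n) s ->
    (forall v : nat -> Htilde Phi, \sum_(d <- s) c d *: theta_word v d = 0) ->
  forall d, d \in s -> c d = 0.
Proof.
move=> us ads sum0 d; have [m] := ubnP (weight d.1.1.2).
elim: m d => // m IHm d dm ds; have ad := allP ads d ds.
have /(congr1 snd) := sum0 (probe Phi d).
rewrite (big_morph _ (fun u w : Htilde Phi => erefl (u + w).2) (erefl _)).
rewrite (bigD1_seq d) //= big_seq_cond big1 => [|d' /andP [d's nd']].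
  rewrite addr0 => /eqP; rewrite scaler_eq0 => /orP [/eqP //|].
  by rewrite (negPf (theta_word_probe_diag Phi ad)).
have [->|nz] := eqVneq (theta_word (probe Phi d) d').2 0.
  by rewrite scaler0.
have [lt|dd] := theta_word_probe0 ad (allP ads d' d's) nz.
  by rewrite IHm ?scale0r //; lia.
by rewrite dd eqxx in nd'.
Qed.

Theorem theorem2 (Phi : fieldType) (char0 : [pchar Phi] =i pred0)
    (n : nat) (n_ge1 : (1 <= n)%N) :
  is_basis (@multilinear_part Phi (@V3tilde Phi) n)
    (theta_admissible n) (@theta Phi (@V3tilde Phi)).
Proof.
split=> [d|s c us ads sum0|u [f [fn ->]]].
- exact: theta_multilinear.
- apply: theta_free us ads _ => v; rewrite -rel_eval_theta.
  have -> := sum0; exact: linear0.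
apply: in_spanP.
have -> : theta (@V3tilde Phi) = theta_word (relgen (@V3tilde Phi)).
  by apply/funext => d; exact: theta_is_word.
(* By linearity it suffices to span the class of each monomial of [f]. *)
have fE : f = \sum_(t <- msupp f) f@_t *: << t >>.
  rewrite {1}[f]monalgE; apply: eq_bigr => t _; apply/malgP => k.
  by rewrite mcoeffZ !mcoeffU mulrnAr mulr1.
rewrite fE linear_sum /= big_seq; elim/big_ind: _ => [|a b|t tf].
- exact: in_span0.
- exact: in_spanD.
rewrite linearZ /= -mon_eval_relgen; apply/in_spanZ/spanned_mon/fn/tf.
exact: relfree_laws (Htilde_laws Phi).
Qed.
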